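(* Let $l\in\mathbb Z$, $h\in\mathbb N$ and $v_1,\dots,v_h\in\mathbb Z$, and let $$V:=v_h+v_{h-1}p+\dots+v_1p^{h-1}.$$ Suppose that $h>1$, $v_1,v_2,\dots,v_h\le p-1$, $V\ge 0$ and $l\ge 0$. Then $$B_{h,l}^{v_1,\dots,v_h}=\delta(V-l;2(p-1))\cdot\sum_{0\le d\le l/2}\ \sum_{\frac{V-p(l-2d)}{2p^2}\le D\le\frac{V-(l-2d)}{2p^2}} q_p(D,d),$$ where $d$ and $D$ run over integers.
   Context: $p$ is a prime. For $a\in\mathbb N$ and $b\in\mathbb Z$, $\delta(b;a)=1$ if $a\mid b$ and $\delta(b;a)=0$ otherwise. For $l\in\mathbb Z$, $h\in\mathbb N$ (positive integers) and $v_1,\dots,v_h\in\mathbb Z$, $B_{h,l}^{v_1,\dots,v_h}$ is the number of $(c_1,\dots,c_h)\in\mathbb Z^h$ such that $\sum_{g=1}^h((p-1)c_g+v_g)=l$ and, for all $g\in\{1,\dots,h\}$, $c_g\equiv V_{g-1}\bmod 2$ and $-v_g/p\le c_g\le pc_{g-1}+v_{g-1}$. Here $c_0=v_0=V_0:=0$ and, for $1\le f\le h$, $V_f:=v_1+\dots+v_f$ if $p\ge 3$ and $V_f:=v_f$ if $p=2$. For integers $D,d$, $q_p(D,d)$ is the number of sequences $n_0,n_1,n_2,\dots$ of non-negative integers with $D=n_0+n_1p+n_2p^2+\cdots$ and $d=n_0+n_1+n_2+\cdots$. *)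

(* Defs.v *)
From mathcomp Require Import all_boot all_order all_algebra finmap.
From mathcomp Require Import mathcomp_extra boolp classical_sets functions.
From mathcomp Require Import cardinality fsbigop.

Set Implicit Arguments.
Unset Strict Implicit.
Unset Printing Implicit Defensive.

Import Order.TTheory GRing.Theory Num.Theory.

Local Open Scope classical_set_scope.
Local Open Scope ring_scope.

Definition delta (b : int) (a : nat) : nat := if (a%:Z %| b)%Z then 1%N else 0%N.

(* 1-based access to [v_1; ...; v_h], with the convention v_0 = 0. *)
Definition entry (h : nat) (v : h.-tuple int) (g : nat) : int :=
  nth 0 (0 :: v) g.

(* The partial sums V_f; both branches give V_0 = 0. *)
Definition Vpart (p h : nat) (v : h.-tuple int) (f : nat) : int :=
  if (3 <= p)%N then \sum_(1 <= i < f.+1) entry v i else entry v f.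

Definition Bset (p h : nat) (l : int) (v : h.-tuple int) : set (h.-tuple int) :=
  [set c : h.-tuple int |
    \sum_(1 <= g < h.+1) ((p%:Z - 1) * entry c g + entry v g) = l /\
    forall g : nat, (1 <= g <= h)%N ->
      [/\ (entry c g = Vpart p v g.-1 %[mod 2])%Z,
          - (entry v g)%:~R / p%:R <= (entry c g)%:~R :> rat &
          entry c g <= p%:Z * entry c g.-1 + entry v g.-1]].

(* [fset_set] returns the empty set on infinite sets, but [Bset] is always
   finite: since c_0 = v_0 = 0, the inequalities bound c_1, then c_2, ... *)
Definition B (p h : nat) (l : int) (v : h.-tuple int) : nat :=
  #|` fset_set (Bset p l v)|%fset.

(* As the terms are natural numbers, finiteness of n_0 + n_1 + ... forces all
   but finitely many terms to vanish; N is a bound on the support. *)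
Definition qset (p : nat) (D d : int) : set (nat -> nat) :=
  [set n : nat -> nat | exists N : nat,
    [/\ forall i : nat, (N <= i)%N -> n i = 0%N,
        D = (\sum_(0 <= i < N) n i * p ^ i)%N%:Z &
        d = (\sum_(0 <= i < N) n i)%N%:Z]].

(* [qset p D d] is finite whenever p >= 2. *)
Definition q (p : nat) (D d : int) : nat := #|` fset_set (qset p D d)|%fset.

Definition Vtotal (p h : nat) (v : h.-tuple int) : int :=
  \sum_(1 <= g < h.+1) entry v g * p%:Z ^+ (h - g)%N.

(* Main.v *)
(** Put [a_g = p c_g + v_g] and let [2 m_g = p c_(g-1) + v_(g-1) - c_g] be the
    slack in the upper bound on [c_g].  The parity conditions say that the [m_g]
    are integers, the upper bounds that they are nonnegative.  Because
    [v_g <= p - 1], the lower bounds [a_g >= 0] all follow from [a_h >= 0].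
    With [n_i = m_(h-i)], telescoping gives [a_h = V - 2p sum_i n_i p^i] and
    [l = a_h + 2 sum_i n_i].  Put [d = n_1 + n_2 + ...] and
    [D = n_1 + n_2 p + ...].  The equation for [l] reads
    [2(p-1) n_0 = V - l + 2d - 2p^2 D].  As [D = d] modulo [p - 1], it has an
    integral solution [n_0] iff [2(p-1)] divides [V - l], and then [n_0 >= 0]
    and [a_h >= 0] are the two bounds on [D].  Finally [V < p^h] makes the bound on
    the length of [n] automatic. *)
Require Import Defs.
From mathcomp Require Import all_boot all_order all_algebra finmap.
From mathcomp Require Import mathcomp_extra boolp classical_sets functions.
From mathcomp Require Import cardinality fsbigop.
From mathcomp Require Import zify ring.

Import Order.TTheory GRing.Theory Num.Theory.

Local Open Scope classical_set_scope.
Local Open Scope ring_scope.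

(** * Parity conditions and lower bounds on the [c_g] *)

Lemma entryE (h : nat) (x : h.-tuple int) (i : 'I_h) :
  entry x i.+1 = tnth x i.
Proof. by rewrite /entry /= (tnth_nth 0). Qed.

Lemma eqz_mod2P (a b : int) :
  (a = b %[mod 2])%Z <-> exists z : int, a - b = 2 * z.
Proof.
split=> [/eqP|[z abz]].
  by rewrite eqz_mod_dvd => /dvdzP[z ->]; exists z; rewrite mulrC.
by apply/eqP; rewrite eqz_mod_dvd abz; apply/dvdzP; exists z; rewrite mulrC.
Qed.

Lemma Vpart0 (p h : nat) (v : h.-tuple int) : Vpart p v 0 = 0.
Proof. by rewrite /Vpart big_geq //; case: ifP. Qed.

(** For odd [p], [p] is 1 modulo 2 and [V_(g+1) = V_g + v_(g+1)]; for [p = 2], [p V_g] is even and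
    [V_(g+1) = v_(g+1)]. *)
Lemma VpartS_mod2 (p h : nat) (v : h.-tuple int) (g : nat) : prime p ->
  exists z : int, p%:Z * Vpart p v g + entry v g.+1 - Vpart p v g.+1 = 2 * z.
Proof.
move=> p_pr; rewrite /Vpart; case: ltnP => [p_gt2|p_le2].
  have p_odd : odd p by case: (even_prime p_pr) p_gt2 => // ->.
  rewrite [in X in _ - X]big_nat_recr //=.
  set S := \sum_(_ <= _ < _) _.
  have -> : p%:Z = 1 + 2 * p./2%:Z.
    by rewrite -[in LHS](odd_double_half p) p_odd -muln2 PoszD PoszM mulrC.
  by exists (p./2%:Z * S); ring.
have -> : p = 2%N by apply/eqP; rewrite eqn_leq p_le2 prime_gt1.
by exists (entry v g); ring.
Qed.

(** Modulo 2, [V_(g+1) = p V_g + v_(g+1)]. Evenness of the slacks says that the [c_(g+1)] obey the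
    same recursion, from the same start [c_1 = 0 = V_0]. *)
Lemma parity_slackP (p h : nat) (v : h.-tuple int) (c : nat -> int) :
    prime p -> c 0%N = 0 ->
  (forall g, (1 <= g <= h)%N -> (c g = Vpart p v g.-1 %[mod 2])%Z) <->
  (forall g, (g < h)%N ->
     exists z : int, p%:Z * c g + entry v g - c g.+1 = 2 * z).
Proof.
move=> p_pr c0; split=> H.
  case=> [|g] g_lt.
    have /eqz_mod2P[z] := H 1%N g_lt; rewrite Vpart0 subr0 => c1.
    by exists (- z); rewrite c0 /entry /=; lia.
  have [z zE] := VpartS_mod2 p h v g p_pr.
  have /eqz_mod2P[x xE] := H g.+1 (ltnW g_lt).
  have /eqz_mod2P[y yE] := H g.+2 g_lt.
  exists (p%:Z * x - y + z); rewrite /= in xE yE.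
  have -> : c g.+1 = 2 * x + Vpart p v g by rewrite -xE; ring.
  have -> : c g.+2 = 2 * y + Vpart p v g.+1 by rewrite -yE; ring.
  have -> : entry v g.+1 = 2 * z + Vpart p v g.+1 - p%:Z * Vpart p v g.
    by rewrite -zE; ring.
  by ring.
case=> // g /=; elim: g => [|g IHg] g_lt; apply/eqz_mod2P.
  have [z] := H 0%N g_lt; rewrite c0 Vpart0 /entry /= => zE.
  by exists (- z); lia.
have [z zE] := VpartS_mod2 p h v g p_pr.
have [y yE] := H g.+1 g_lt.
have /eqz_mod2P[x xE] := IHg (ltnW g_lt).
exists (p%:Z * x - y + z).
have -> : c g.+2 = p%:Z * c g.+1 + entry v g.+1 - 2 * y by rewrite -yE; ring.
have -> : c g.+1 = 2 * x + Vpart p v g by rewrite -xE; ring.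
have -> : Vpart p v g.+1 = p%:Z * Vpart p v g + entry v g.+1 - 2 * z.
  by rewrite -zE; ring.
by ring.
Qed.

Lemma lower_boundE (p : nat) (x y : int) : (0 < p)%N ->
  (- x%:~R / p%:R <= y%:~R :> rat) = (0 <= p%:Z * y + x).
Proof.
move=> p_gt0; rewrite ler_pdivrMr ?ltr0n // -subr_ge0 opprK.
by rewrite -[p%:R]/(p%:Z%:~R) -intrM -intrD ler0z mulrC.
Qed.

(** * Chains and their slacks *)

Definition weight (p N : nat) (n : nat -> nat) : nat :=
  \sum_(0 <= i < N) n i * p ^ i.

Definition total (N : nat) (n : nat -> nat) : nat := \sum_(0 <= i < N) n i.

(** The [c_g] rebuilt from their slacks: [s g] is half the slack in the upper bound on [c_(g+1)]. *)
Fixpoint chain (p : int) (v : nat -> int) (s : nat -> nat) (g : nat) : int :=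
  if g is g'.+1 then p * chain p v s g' + v g' - 2 * (s g')%:Z else 0.

(** With [a_g = p c_g + v_g], each term is [a_g - c_g = a_g - a_(g-1) + 2 s_(g-1)]; this telescopes
    from [a_0 = 0]. *)
Lemma chain_sum (p : int) (v : nat -> int) (s : nat -> nat) (k : nat) :
  v 0%N = 0 ->
  \sum_(1 <= g < k.+1) ((p - 1) * chain p v s g + v g) =
  p * chain p v s k + v k + 2 * (\sum_(0 <= g < k) s g)%N%:Z.
Proof.
move=> v0; elim: k => [|k IHk]; first by rewrite !big_geq //= v0; ring.
by rewrite big_nat_recr //= IHk [in RHS]big_nat_recr //= PoszD; ring.
Qed.

(** The recursion [a_(k+1) = p (a_k - 2 s_k) + v_(k+1)] is a Horner scheme. *)
Lemma chain_value (p : nat) (v : nat -> int) (s : nat -> nat) (k : nat) :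
  v 0%N = 0 ->
  p%:Z * chain p v s k + v k =
  \sum_(1 <= g < k.+1) v g * p%:Z ^+ (k - g) -
  2 * p%:Z * (\sum_(0 <= g < k) s g * p ^ (k - g.+1))%N%:Z.
Proof.
move=> v0; elim: k => [|k IHk]; first by rewrite !big_geq //= v0; ring.
have E1 : \sum_(1 <= g < k.+2) v g * p%:Z ^+ (k.+1 - g) =
    p%:Z * (\sum_(1 <= g < k.+1) v g * p%:Z ^+ (k - g)) + v k.+1.
  rewrite big_nat_recr //= subnn expr0 mulr1 mulr_sumr; congr (_ + _).
  by apply: eq_big_nat => g /andP[_ gk]; rewrite subSn // exprS; ring.
have E2 : (\sum_(0 <= g < k.+1) s g * p ^ (k.+1 - g.+1) =
    p * (\sum_(0 <= g < k) s g * p ^ (k - g.+1)) + s k)%N.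
  rewrite big_nat_recr //= subnn expn0 muln1 big_distrr /=; congr (_ + _)%N.
  by apply: eq_big_nat => g /andP[_ gk]; rewrite subSS -subnSK // expnS mulnCA.
rewrite E1 E2 /= IHk PoszD PoszM; ring.
Qed.

Lemma sum_rev (N : nat) (n : nat -> nat) :
  (\sum_(0 <= g < N) n (N - g.+1) = total N n)%N.
Proof. by rewrite /total [RHS]big_nat_rev; apply: eq_bigr => i _; rewrite add0n. Qed.

Lemma weight_rev (p N : nat) (n : nat -> nat) :
  (\sum_(0 <= g < N) n (N - g.+1) * p ^ (N - g.+1) = weight p N n)%N.
Proof. by rewrite /weight [RHS]big_nat_rev; apply: eq_bigr => i _; rewrite add0n. Qed.

(* The slack sequences [n] of the chains [c] counted by [B], listed backwards:
   [2 * n (h - g) = p * c_(g-1) + v_(g-1) - c_g]. *)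
Definition slacks (p h : nat) (V l : int) : set (nat -> nat) :=
  [set n | [/\ forall i, (h <= i)%N -> n i = 0%N,
     0 <= V - 2 * p%:Z * (weight p h n)%:Z &
     V - 2 * p%:Z * (weight p h n)%:Z + 2 * (total h n)%:Z = l]].

(** Reversing the order gives [n i] the weight [p ^ i] in [a_h]. *)
Definition slack_tuple (p h : nat) (v : h.-tuple int) (n : nat -> nat) :
    h.-tuple int :=
  [tuple chain p (entry v) (fun g => n (h - g.+1)%N) i.+1 | i < h].

Lemma entry_slack_tuple (p h : nat) (v : h.-tuple int) n g : (g <= h)%N ->
  entry (slack_tuple p h v n) g = chain p (entry v) (fun g => n (h - g.+1)%N) g.
Proof.
case: g => [//|g] gh.
by rewrite -[g]/(nat_of_ord (Ordinal gh)) entryE tnth_mktuple.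
Qed.

(* Since [a_g = p c_g + v_g] and [v_g <= p - 1], [a_g >= 0] forces [c_g >= 0],
   hence [a_(g-1) = c_g + 2 s_g >= 0]. *)
Lemma chain_ge0 (p : nat) (v : nat -> int) (s : nat -> nat) (h g : nat) :
    (forall i, (1 <= i <= h)%N -> v i <= p%:Z - 1) ->
    0 <= p%:Z * chain p v s h + v h -> (1 <= g <= h)%N ->
  0 <= p%:Z * chain p v s g + v g.
Proof.
move=> + + /andP[g_gt0]; elim: h => [|h IHh] hv ah_ge0; first by case: g g_gt0.
rewrite leq_eqVlt => /predU1P[->//|gh].
apply: IHh => // [i /andP[i_gt0 ih]|]; first by apply: hv; rewrite i_gt0 ltnW.
have vh := hv h.+1 (leqnn _).
have : 0 <= chain p v s h.+1 by nia.
by rewrite /=; lia.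
Qed.

Lemma Bset_slacks (p h : nat) (l : int) (v : h.-tuple int) : prime p ->
    (forall g : nat, (1 <= g <= h)%N -> entry v g <= p%:Z - 1) ->
    (0 < h)%N ->
  Bset p l v = slack_tuple p h v @` slacks p h (Vtotal p v) l.
Proof.
move=> p_pr hv h_gt0.
(* [aE] and [sE] turn the lower bound for [g = h] and the sum condition into the two numerical
   conditions of [slacks]. *)
have aE n : p%:Z * chain p (entry v) (fun g => n (h - g.+1)%N) h + entry v h =
    Vtotal p v - 2 * p%:Z * (weight p h n)%:Z.
  by rewrite chain_value // weight_rev.
have sE n : \sum_(1 <= g < h.+1) ((p%:Z - 1) *
      chain p (entry v) (fun g => n (h - g.+1)%N) g + entry v g) =
    Vtotal p v - 2 * p%:Z * (weight p h n)%:Z + 2 * (total h n)%:Z.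
  by rewrite chain_sum // sum_rev aE.
apply/seteqP; split=> [c [csum cP]|_ [n [n_supp a_ge0 nl] <-]] /=; last first.
  set s := fun g => n (h - g.+1)%N.
  have eC g : (g <= h)%N -> entry (slack_tuple p h v n) g = chain p (entry v) s g.
    by move=> ?; rewrite entry_slack_tuple.
  split.
    by rewrite -nl -sE; apply: eq_big_nat => g /andP[_ gh]; rewrite eC.
  move=> g gh; have /andP[g_gt0 g_le] := gh; split.
  - rewrite eC //; move: g gh {g_gt0 g_le}; apply/parity_slackP => // g gh.
    by exists (s g)%:Z => /=; ring.
  - rewrite lower_boundE ?prime_gt0 // eC //.
    by apply: (chain_ge0 _ _ _ h) => //; rewrite aE.
  - rewrite !eC //; last by lia.
    by case: g g_gt0 {gh g_le} => //= g _; lia.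
have /parity_slackP sP : forall g, (1 <= g <= h)%N ->
    (entry c g = Vpart p v g.-1 %[mod 2])%Z by move=> g /cP[].
have {}sP := sP p_pr erefl.
(* Parity makes the slacks even, and the upper bounds make their halves natural numbers. *)
have /choice[s sE'] (g : nat) : exists s : nat, (g < h)%N ->
    p%:Z * entry c g + entry v g - entry c g.+1 = 2 * s%:Z.
  have [gh|] := ltnP g h; last by exists 0%N.
  have [z zE] := sP g gh.
  have [_ _ /=] := cP g.+1 gh.
  rewrite -subr_ge0 [X in 0 <= X]zE => z_ge0.
  by exists `|z|%N => _; rewrite zE; lia.
pose n i := if (i < h)%N then s (h - i.+1)%N else 0%N.
have cE g : (g <= h)%N ->
    entry c g = chain p (entry v) (fun g => n (h - g.+1)%N) g.
  elim: g => [//|g IHg] gh /=.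
  rewrite -IHg ?(ltnW gh) // /n ifT; last by lia.
  have -> : (h - (h - g.+1).+1)%N = g by lia.
  by have := sE' g gh; lia.
exists n; last first.
  by apply: eq_from_tnth => i; rewrite -!entryE entry_slack_tuple ?cE.
split.
- by move=> i hi; rewrite /n ltnNge hi.
- rewrite -aE -cE // -lower_boundE ?prime_gt0 //.
  by have [] := cP h _; rewrite ?h_gt0 ?leqnn.
- by rewrite -sE -csum; apply: eq_big_nat => g /andP[_ gh]; rewrite cE.
Qed.

(** Consecutive entries of a chain determine the slack between them, hence each [n i] with [i < h];
    the other terms vanish. *)
Lemma slack_tuple_inj (p h : nat) (v : h.-tuple int) (V l : int) :
  {in slacks p h V l &, injective (slack_tuple p h v)}.
Proof.
move=> n n' /set_mem[n_supp _ _] /set_mem[n'_supp _ _] eq_nn'.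
apply/funext => i; have [ih|hi] := ltnP i h; last by rewrite n_supp ?n'_supp.
have E g : (g <= h)%N -> chain p (entry v) (fun g => n (h - g.+1)%N) g =
    chain p (entry v) (fun g => n' (h - g.+1)%N) g.
  by move=> gh; rewrite -!entry_slack_tuple // eq_nn'.
have := E (h - i.+1)%N (leq_subr _ _).
have := E (h - i.+1).+1 => /=.
have -> : (h - (h - i.+1).+1)%N = i by lia.
lia.
Qed.

(** * Finiteness and counting by fibres *)

Lemma finite_int_segment (a b : int) : finite_set [set x : int | a <= x <= b].
Proof.
apply: (@sub_finite_set _ _ ((fun i : nat => a + i%:Z) @` `I_(`|b - a|).+1)).
  by move=> x /= ax; exists `|x - a|%N => /=; lia.
by apply: finite_image; exact: finite_II.
Qed.

Lemma card_fset_set_image (T U : choiceType) (f : T -> U) (X : set T) :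
    finite_set X -> {in X &, injective f} ->
  #|` fset_set (f @` X)|%fset = #|` fset_set X|%fset.
Proof.
move=> X_fin f_inj; rewrite fset_set_image //; apply/eqP/card_in_imfsetP.
by move=> x y; rewrite !in_fset_set //; exact: f_inj.
Qed.

(** Double counting: each [x] contributes once, at [y = f x]. *)
Lemma card_fset_set_fibers (T U : choiceType) (X : set T) (A : set U)
    (f : T -> U) : finite_set X -> finite_set A -> f @` X `<=` A ->
  #|` fset_set X|%fset =
  \sum_(y \in A) #|` fset_set (X `&` f @^-1` [set y])|%fset.
Proof.
move=> X_fin A_fin fXA; rewrite fsbig_finite //= -sum1_size.
rewrite [LHS](_ : _ =
    \sum_(x <- fset_set X) \sum_(y <- fset_set A) (f x == y)%N)%N.
  rewrite exchange_big; apply: eq_bigr => y _.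
  rewrite -sum1_size -big_mkcond -[LHS]big_filter; apply: perm_big.
  apply: uniq_perm; rewrite ?filter_uniq ?fset_uniq // => x.
  rewrite mem_filter !in_fset_set //; last exact: finite_setIl.
  rewrite in_setI andbC; congr (_ && _).
  by apply/eqP/idP => [?|/set_mem//]; apply/mem_set.
apply: eq_big_seq => x; rewrite in_fset_set // => /set_mem Xx.
rewrite -big_mkcond sum1_count -(eq_count (fun y => eq_sym _ _)).
by rewrite count_uniq_mem // in_fset_set // mem_set //; apply: fXA; exists x.
Qed.

(** Since [a_h >= 0], twice the total is at most [l], which bounds every term. *)
Lemma slacks_finite (p h : nat) (V l : int) : finite_set (slacks p h V l).
Proof.
pose F (t : {ffun 'I_h -> 'I_(`|l|.+1)}) (i : nat) : nat :=
  if insub i is Some j then t j else 0%N.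
apply: (@sub_finite_set _ _ (F @` [set: _])); last exact: finite_image.
move=> n [n_supp a_ge0 nl].
have n_le i : (i < h)%N -> (n i <= `|l|)%N.
  move=> ih; have : (n i <= total h n)%N.
    by rewrite /total big_mkord (bigD1 (Ordinal ih)) //= leq_addr.
  lia.
exists [ffun i : 'I_h => inord (n i)] => //; apply/funext => i; rewrite /F.
case: insubP => [j _ <-|]; last by rewrite -leqNgt => /n_supp.
by rewrite ffunE inordK // ltnS n_le.
Qed.

(** * Elimination of the first term [n_0] *)

Lemma weightS (p N : nat) (n : nat -> nat) :
  weight p N.+1 n = (n 0 + p * weight p N (fun i => n i.+1))%N.
Proof.
rewrite /weight big_nat_recl // muln1 big_distrr; congr (_ + _)%N.
by apply: eq_bigr => i _; rewrite expnS mulnCA.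
Qed.

Lemma totalS (N : nat) (n : nat -> nat) :
  total N.+1 n = (n 0 + total N (fun i => n i.+1))%N.
Proof. by rewrite /total big_nat_recl. Qed.

(** Every power of [p] is 1 modulo [p - 1]. *)
Lemma weight_total_mod (p N : nat) (n : nat -> nat) :
  exists z : int, (weight p N n)%:Z = (total N n)%:Z + (p%:Z - 1) * z.
Proof.
elim: N n => [|N IHN] n; first by exists 0; rewrite /weight /total !big_geq ?mulr0.
have [z zE] := IHN (fun i => n i.+1).
exists (z + (weight p N (fun i => n i.+1))%:Z).
rewrite weightS totalS !PoszD PoszM.
have -> : (total N (fun i => n i.+1))%:Z =
  (weight p N (fun i => n i.+1))%:Z - (p%:Z - 1) * z by rewrite zE; ring.
by ring.
Qed.

(** With weight [w] and total [t], [V - l = 2 (p w - t)] and [p w - t = (p - 1) w + (w - t)]. *)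
Lemma slacks_dvd (p h : nat) (V l : int) (n : nat -> nat) :
  (0 < p)%N -> slacks p h V l n -> ((2 * (p - 1))%N%:Z %| V - l)%Z.
Proof.
move=> p_gt0 [_ _ <-]; have [z zE] := weight_total_mod p h n.
apply/dvdzP; exists ((weight p h n)%:Z + z).
have -> : (total h n)%:Z = (weight p h n)%:Z - (p%:Z - 1) * z by rewrite zE; ring.
by rewrite PoszM -subzn //; ring.
Qed.

(** Candidates for [n_1, n_2, ...]: the bounds on [d] and [D] in the double sum, with denominators
    cleared. *)
Definition tails (p k : nat) (V l : int) : set (nat -> nat) :=
  [set n | [/\ forall i, (k <= i)%N -> n i = 0%N,
     2 * (total k n)%:Z <= l,
     V - p%:Z * (l - 2 * (total k n)%:Z) <= (2 * p ^ 2)%N%:Z * (weight p k n)%:Z &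
     (2 * p ^ 2)%N%:Z * (weight p k n)%:Z <= V - (l - 2 * (total k n)%:Z)]].

(** The bounds on [D] express [a_h >= 0] and [n_0 >= 0], because
    [(p - 1) a_h = 2p^2 D - (V - p (l - 2d))] and [2 (p - 1) n_0 = V - (l - 2d) - 2p^2 D]. *)
Lemma tails_slacks (p k : nat) (V l : int) : (1 < p)%N ->
    ((2 * (p - 1))%N%:Z %| V - l)%Z ->
  tails p k V l = (fun n i => n i.+1) @` slacks p k.+1 V l.
Proof.
move=> p_gt1 /dvdzP[y]; rewrite PoszM -subzn ?(ltnW p_gt1) // => yE.
have p1_gt0 : 0 < p%:Z - 1 by lia.
have p2 : (2 * p ^ 2)%N%:Z = 2 * p%:Z * p%:Z by rewrite !PoszM mulrA.
apply/seteqP; split=> [n|_ [n [n_supp + +] <-]]; last first.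
  rewrite weightS totalS !PoszD PoszM /tails /= p2.
  set D := (weight _ _ _)%:Z; set d := (total _ _)%:Z => a_ge0 lE.
  split.
  - by move=> i ki; exact: n_supp.
  - by lia.
  - rewrite -subr_ge0.
    have -> : 2 * p%:Z * p%:Z * D - (V - p%:Z * (l - 2 * d)) =
      (p%:Z - 1) * (V - 2 * p%:Z * ((n 0%N)%:Z + p%:Z * D)) by rewrite -lE; ring.
    by rewrite mulr_ge0 // ltW.
  - rewrite -subr_ge0.
    have -> : V - (l - 2 * d) - 2 * p%:Z * p%:Z * D =
      2 * (p%:Z - 1) * (n 0%N)%:Z by rewrite -lE; ring.
    by rewrite !mulr_ge0 // ltW.
rewrite /tails /= p2 => -[n_supp].
have [z] := weight_total_mod p k n.
set D := (weight _ _ _)%:Z; set d := (total _ _)%:Z => zE d_le D_ge D_le.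
(* This is [n_0]: divide [V - l + 2d - 2p^2 D] by [2 (p - 1)], using [d = D - (p - 1) z] and
   [p^2 - 1 = (p - 1) (p + 1)]. *)
pose x := y - z - (p%:Z + 1) * D.
have xE : V - (l - 2 * d) - 2 * p%:Z * p%:Z * D = 2 * (p%:Z - 1) * x.
  have -> : V - (l - 2 * d) = (V - l) + 2 * d by ring.
  have -> : d = D - (p%:Z - 1) * z by rewrite zE; ring.
  by rewrite yE /x; ring.
have x_ge0 : 0 <= x.
  rewrite -(pmulr_rge0 _ p1_gt0) -(pmulr_rge0 _ (ltr0Sn int 1)) mulrA -xE.
  by rewrite subr_ge0.
exists (fun i => if i is j.+1 then n j else `|x|%N) => //.
split; first by case=> // i ki; exact: n_supp.
(* Multiplied by [p - 1], the inequality [a_h >= 0] becomes the lower bound on [D]. *)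
- rewrite weightS PoszD PoszM gez0_abs //= -/D -(pmulr_rge0 _ p1_gt0).
  have -> : (p%:Z - 1) * (V - 2 * p%:Z * (x + p%:Z * D)) =
      (p%:Z - 1) * V - p%:Z * (2 * (p%:Z - 1) * x)
      - 2 * p%:Z * p%:Z * D * (p%:Z - 1) by ring.
  rewrite -xE -[X in _ <= X](_ : 2 * p%:Z * p%:Z * D -
      (V - p%:Z * (l - 2 * d)) = _) ?subr_ge0 //; ring.
- rewrite weightS totalS !PoszD PoszM gez0_abs //= -/D -/d.
  have -> : V = 2 * (p%:Z - 1) * x + 2 * p%:Z * p%:Z * D + (l - 2 * d).
    by rewrite -xE; ring.
  by ring.
Qed.

(** In the equation for [l], [n_0] has the nonzero coefficient [-2 (p - 1)], so the later terms
    determine it. *)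
Lemma slacks_shift_inj (p k : nat) (V l : int) : (1 < p)%N ->
  {in slacks p k.+1 V l &, injective (fun n i => n i.+1 : nat)}.
Proof.
move=> p_gt1 n n' /set_mem[_ _ nl] /set_mem[_ _ n'l] eq_nn'.
apply/funext=> -[|i]; last exact: (congr1 (fun f => f i) eq_nn').
move: nl n'l; rewrite !weightS !totalS eq_nn' !PoszD !PoszM => <- E.
have : (p%:Z - 1) * ((n 0%N)%:Z - (n' 0%N)%:Z) = 0 by nia.
by move/eqP; rewrite mulf_eq0 => /orP[] /eqP; lia.
Qed.

(** * Tails counted by [q] *)

Lemma sum_supp (N M : nat) (F : nat -> nat) :
    (forall i, (N <= i)%N -> F i = 0%N) -> (N <= M)%N ->
  (\sum_(0 <= i < M) F i = \sum_(0 <= i < N) F i)%N.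
Proof.
move=> F_supp NM; rewrite (big_cat_nat (leq0n N) NM) //= [X in (_ + X)%N]big_nat.
by rewrite [X in (_ + X)%N]big1 ?addn0 // => i /andP[/F_supp].
Qed.

Lemma sum_supp2 (N M : nat) (F : nat -> nat) :
    (forall i, (N <= i)%N -> F i = 0%N) -> (forall i, (M <= i)%N -> F i = 0%N) ->
  (\sum_(0 <= i < M) F i = \sum_(0 <= i < N) F i)%N.
Proof.
move=> FN FM; have [NM|/ltnW MN] := leqP N M; first exact: sum_supp.
by apply/esym; exact: sum_supp.
Qed.

(** A nonzero term at some [i >= k] would give [D >= p ^ i >= p ^ k]. *)
Lemma qset_supp (p k : nat) (D d : int) : (1 < p)%N -> D < p%:Z ^+ k ->
  qset p D d = [set n | [/\ forall i, (k <= i)%N -> n i = 0%N,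
                        (total k n)%:Z = d & (weight p k n)%:Z = D]].
Proof.
move=> p_gt1 D_lt; apply/seteqP; split=> n; last first.
  by case=> n_supp dE DE; exists k.
case=> N [nN DE dE].
have nk i : (k <= i)%N -> n i = 0%N.
  move=> ki; have [iN|] := ltnP i N; last exact: nN.
  case En : (n i) => [//|m]; move: D_lt; rewrite DE big_mkord.
  rewrite (bigD1 (Ordinal iN)) //= En -[X in X ^+ _]natz -natrX natz ltz_nat ltnNge.
  case/negP; apply: leq_trans (leq_addr _ _); rewrite mulSn.
  by apply: leq_trans (leq_addr _ _); rewrite leq_exp2l.
have nk' i : (k <= i)%N -> (n i * p ^ i = 0)%N by move/nk->.
have nN' i : (N <= i)%N -> (n i * p ^ i = 0)%N by move/nN->.
by split=> //; rewrite ?dE ?DE /total /weight (sum_supp2 N k).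
Qed.

Lemma Vtotal_lt (p h : nat) (v : h.-tuple int) :
    (forall g : nat, (1 <= g <= h)%N -> entry v g <= p%:Z - 1) ->
  Vtotal p v < p%:Z ^+ h.
Proof.
move=> hv; rewrite /Vtotal.
(* The reserve [p ^ (h - k)] pays for the next term, at most [(p - 1) p ^ (h - k - 1)], and the next
   reserve. At [k = h] it is 1, which makes the bound strict. *)
suff H k : (k <= h)%N ->
    \sum_(1 <= g < k.+1) entry v g * p%:Z ^+ (h - g) + p%:Z ^+ (h - k)
    <= p%:Z ^+ h.
  by have := H h (leqnn h); rewrite subnn expr0; lia.
elim: k => [|k IHk] kh; first by rewrite big_geq // add0r subn0.
apply: le_trans (IHk (ltnW kh)).
rewrite big_nat_recr //= -addrA lerD2l -(subnSK kh) exprS.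
rewrite -[X in _ + X]mul1r -mulrDl ler_wpM2r ?exprn_ge0 //.
by have := hv k.+1; rewrite kh => /(_ isT); lia.
Qed.

Lemma divz_le_ratE (a b : int) (m : nat) : (0 < m)%N ->
  (a%:~R / m%:R <= b%:~R :> rat) = (a <= m%:Z * b).
Proof.
move=> m_gt0; rewrite ler_pdivrMr ?ltr0n // -[m%:R]/(m%:Z%:~R) -intrM ler_int.
by rewrite mulrC.
Qed.

Lemma ratE_le_divz (a b : int) (m : nat) : (0 < m)%N ->
  (b%:~R <= a%:~R / m%:R :> rat) = (m%:Z * b <= a).
Proof.
move=> m_gt0; rewrite ler_pdivlMr ?ltr0n // -[m%:R]/(m%:Z%:~R) -intrM ler_int.
by rewrite mulrC.
Qed.

(** Tails are sorted by total [d], then by weight [D]; each fibre is all of [qset p D d], since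
    [D < p ^ k]. *)
Lemma card_tails (p k : nat) (V l : int) : (1 < p)%N ->
    V < p%:Z ^+ k.+1 -> finite_set (tails p k V l) ->
  #|` fset_set (tails p k V l)|%fset =
  \sum_(d \in [set d : int | 0 <= d /\ (d%:~R <= l%:~R / 2%:R :> rat)])
     \sum_(D \in [set D : int |
         ((V - p%:Z * (l - 2 * d))%:~R / (2 * p ^ 2)%N%:R
            <= D%:~R :> rat) /\
         (D%:~R <= (V - (l - 2 * d))%:~R / (2 * p ^ 2)%N%:R :> rat)])
       q p D d.
Proof.
move=> p_gt1 V_lt fin.
have p2_gt0 : (0 < 2 * p ^ 2)%N by rewrite muln_gt0 expn_gt0; lia.
rewrite (@card_fset_set_fibers _ _ _
  [set d : int | 0 <= d /\ (d%:~R <= l%:~R / 2%:R :> rat)]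
  (fun n => (total k n)%:Z)) //; first last.
- by move=> _ [n [_ d_le _ _] <-] /=; rewrite ratE_le_divz.
- apply: sub_finite_set (finite_int_segment 0 l) => d /=.
  by rewrite ratE_le_divz //; lia.
apply: eq_fsbigr => d /set_mem[d_ge0]; rewrite ratE_le_divz // => d_le.
set A := [set D : int | _].
have AE D : A D <->
    V - p%:Z * (l - 2 * d) <= (2 * p ^ 2)%N%:Z * D <= V - (l - 2 * d).
  by rewrite /A /= divz_le_ratE // ratE_le_divz //; split=> /andP.
rewrite (@card_fset_set_fibers _ _ _ A (fun n => (weight p k n)%:Z)) //; first last.
- by move=> _ [n [[_ _ D_ge D_le] /= dE] <-]; apply/AE; rewrite -dE D_ge.
- apply: sub_finite_set (finite_int_segment
    (- `|V - p%:Z * (l - 2 * d)|) `|V - (l - 2 * d)|) => D /AE /=.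
  by move: (2 * p ^ 2)%N p2_gt0 => m m_gt0; nia.
- exact: finite_setIl.
apply: eq_fsbigr => D /set_mem /AE D_bd; congr #|` fset_set _|%fset.
rewrite (@qset_supp p k D d) //.
  apply/seteqP; split=> n /=; first by case=> -[[? _ _ _] ? ?].
  by case=> n_supp dE DE; do !split=> //; rewrite dE ?DE; case/andP: D_bd.
(* For [D > 0], [p D <= 2p^2 D <= V - (l - 2d) <= V < p ^ (k + 1)]. *)
have [D_le0|D_gt0] := lerP D 0.
  by apply: le_lt_trans D_le0 _; rewrite exprn_gt0 // ltz_nat ltnW.
rewrite -(ltr_pM2l (_ : 0 < p%:Z)) ?ltz_nat ?(ltnW p_gt1) // -exprS.
apply: le_lt_trans V_lt; case/andP: D_bd => _.
rewrite !PoszM; nia.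
Qed.

(** * Reduction of [B] to the count of tails *)

Theorem theorem26 (p : nat) (hp : prime p) (l : int) (h : nat)
    (v : h.-tuple int) (hh : (1 < h)%N)
    (hv : forall g : nat, (1 <= g <= h)%N -> entry v g <= p%:Z - 1)
    (hV : 0 <= Vtotal p v) (hl : 0 <= l) :
  B p l v =
  (delta (Vtotal p v - l) (2 * (p - 1)) *
   (\sum_(d \in [set d : int | 0 <= d /\ (d%:~R <= l%:~R / 2%:R :> rat)])
     \sum_(D \in [set D : int |
         ((Vtotal p v - p%:Z * (l - 2 * d))%:~R / (2 * p ^ 2)%N%:R
            <= D%:~R :> rat) /\
         (D%:~R <= (Vtotal p v - (l - 2 * d))%:~R / (2 * p ^ 2)%N%:R :> rat)])
       q p D d)%R)%N.
Proof.
have p_gt1 := prime_gt1 hp; have p_gt0 := prime_gt0 hp.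
rewrite /B Bset_slacks ?(ltnW hh) // card_fset_set_image; first last.
- exact: slack_tuple_inj.
- exact: slacks_finite.
have V_lt := Vtotal_lt p h v hv.
(* Without the divisibility there are no slack sequences at all. *)
rewrite /delta; case: ifP => [dvd|ndvd]; last first.
  rewrite mul0n (_ : slacks _ _ _ _ = set0) ?fset_set0 ?cardfs0 //.
  by apply/seteqP; split=> // n /slacks_dvd - /(_ p_gt0); rewrite ndvd.
(* With [h = k + 1], deleting [n_0] maps the slack sequences bijectively onto tails of length
   [k]. *)
rewrite mul1n; case: h v hh hv hV V_lt dvd => [//|k] v _ _ _ V_lt dvd.
have tE := tails_slacks p k _ l p_gt1 dvd.
rewrite -(card_tails p k _ l p_gt1 V_lt) tE.
  rewrite card_fset_set_image //; first exact: slacks_finite.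
  exact: slacks_shift_inj.
by apply: finite_image; exact: slacks_finite.
Qed.
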